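(* Let $\mathfrak{I}$ be a loopblind boolean interaction family that is group--coset, globally satisfiable, functionally representable, and contraction-closed. Then for every loopless hypergraph $G=(V,E)$, the rank function $r_{\mathcal{M}(G;\mathfrak{I})}$ is (the rank function of) a polymatroid on $E$.
   Context: Hypergraphs. A hypergraph $G=(V,E)$ has a finite vertex set $V$ and a finite multiset $E$ of hyperedges, each a finite multiset of elements of $V$ (empty hyperedges allowed; repeated hyperedges count as distinct elements of $E$). $G$ is loopless if every hyperedge is a set. Interaction families. A boolean interaction family $\mathfrak{I}=(S,\{\Phi^k\}_{k\ge0})$ is a finite set $S$, $q=|S|\ge2$, with permutation-invariant functions $\Phi^k\colon S^k\to\{0,1\}$; for a finite (multi)set $A$ of indices, $\Phi^{|A|}(\boldsymbol{s}|_A)$ is $\Phi^{|A|}$ applied to the entries $s_i$, $i\in A$ (with multiplicity). Put $K_{\Phi^k}=\{\boldsymbol{s}\in S^k\mid\Phi^k(\boldsymbol{s})=1\}$. The induced model $\mathcal{M}(G;\mathfrak{I})$ has interaction functions $\phi^e(\boldsymbol{s})=\Phi^{|e|}(\boldsymbol{s}|_e)$, $\boldsymbol{s}\in S^V$, $e\in E$. Loopblind: for every $k>0$ and every multisubset $A$ of $[k]$ such that $\boldsymbol{s}\mapsto\Phi^{|A|}(\boldsymbol{s}|_A)$ is not constant on $S^k$, there is a unique subset (set) $A'\subseteq A$ with $\Phi^{|A|}(\boldsymbol{s}|_A)=\Phi^{|A'|}(\boldsymbol{s}|_{A'})$ for all $\boldsymbol{s}\in S^k$. Group--coset: $S$ is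 a finite group and for all $k\ge0$ the set $K_{\Phi^k}$ is a coset of a subgroup of $S^k$. Globally satisfiable: there is $s\in S$ such that $\Phi^k(s,\dots,s)=1$ for all $k$. Functionally representable: for every $k$ there is a partition $[k]=I\sqcup D$ and a map $\sigma\colon S^{|I|}\to S^{|D|}$ (dependency map) with $K_{\Phi^k}=\{(\boldsymbol{s}_I,\sigma(\boldsymbol{s}_I))\mid\boldsymbol{s}_I\in S^{|I|}\}$ ($\boldsymbol{s}_I$ placed on $I$, $\sigma(\boldsymbol{s}_I)$ on $D$). Contraction-closed: for every $k$, every $k'\ge k$ and every partition $[k]=I\sqcup D$ with a map $\sigma\colon S^{|I|}\to S^{|D|}$ satisfying $K_{\Phi^k}=\{(\boldsymbol{s}_I,\sigma(\boldsymbol{s}_I))\mid\boldsymbol{s}_I\in S^{|I|}\}$ ($\boldsymbol{s}_I$ placed on $I$, $\sigma(\boldsymbol{s}_I)$ on $D$), let $\hat\sigma\colon S^{[k']\setminus D}\to S^{[k']}$, $\hat\sigma(\boldsymbol{s})|_{[k']\setminus D}=\boldsymbol{s}$, $\hat\sigma(\boldsymbol{s})|_D=\sigma(\boldsymbol{s}|_I)$; then for every $A\subseteq[k']$ either $\Phi^{|A|}(\hat\sigma(\boldsymbol{s})|_A)$ is constant in $\boldsymbol{s}$, or there is a unique $A'\subseteq[k']\setminus D$ with $\Phi^{|A|}(\hat\sigma(\boldsymbol{s})|_A)=\Phi^{|A'|}(\boldsymbol{s}|_{A'})$ for all $\boldsymbol{s}\in S^{[k']\setminus D}$. Rank function: $R_{\mathcal{M}}(A)=\#\{\boldsymbol{s}\in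 S^V\mid\phi^e(\boldsymbol{s})=1\ \forall e\in A\}$; $r_{\mathcal{M}}(A)=|V|-\log_qR_{\mathcal{M}}(A)$ if $R_{\mathcal{M}}(A)>0$ and $\infty$ otherwise, for $A\subseteq E$. Polymatroid: a pair $(E,r)$ with $E$ finite and $r\colon2^E\to\mathbb{R}_{\ge0}$ such that $r(\emptyset)=0$; $r(A)\le r(B)$ for $A\subseteq B\subseteq E$; $r(A)+r(B)\ge r(A\cup B)+r(A\cap B)$ for all $A,B\subseteq E$; and $r(A)\in\mathbb{Z}_{\ge0}$ for all $A\subseteq E$. *)

(* Defs.v *)
(* MathComp / MathComp-Analysis; multisets are those of finmap. *)
From HB Require Import structures.
From mathcomp Require Import all_boot all_order all_algebra all_fingroup.
From mathcomp Require Import finmap multiset.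
From mathcomp Require Import reals constructive_ereal exp.

Set Implicit Arguments.
Unset Strict Implicit.
Unset Printing Implicit Defensive.

Import Order.TTheory GRing.Theory Num.Theory.

Local Open Scope mset_scope.
Local Open Scope ring_scope.

(* The hyperedges form a multiset: they are indexed by [hedge], and [inc] need
   not be injective. *)
Record hypergraph := Hypergraph {
  vertex : finType;
  hedge : finType;
  inc : hedge -> {mset vertex}
}.

Definition loopless (G : hypergraph) : Prop :=
  forall (e : hedge G) (v : vertex G), (inc e v <= 1)%N.

(* S^k is rendered as {ffun 'I_k -> S}, and S^I as {ffun I -> S}. *)
Record interaction_family (S : finType) := InteractionFamily {
  Phi :> forall k : nat, {ffun 'I_k -> S} -> bool;
  Phi_perm : forall (k : nat) (p : 'S_k) (s : {ffun 'I_k -> S}),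
    Phi [ffun i => s (p i)] = Phi s;
  card_state_gt1 : (1 < #|S|)%N
}.

Section Restriction.
Variables (S I : finType) (F : interaction_family S).

(* By [Phi_perm], the order of the entries of [w] is irrelevant. *)
Definition Phi_seq (w : seq I) (s : {ffun I -> S}) : bool :=
  F _ [ffun i : 'I_(size w) => s (tnth (in_tuple w) i)].

Definition Phi_mset (A : {mset I}) : {ffun I -> S} -> bool :=
  Phi_seq (enum_mset A).

Definition Phi_set (A : {set I}) : {ffun I -> S} -> bool := Phi_seq (enum A).

End Restriction.

Definition constant_fun (X Y : Type) (f : X -> Y) : Prop :=
  exists c : Y, forall x : X, f x = c.

Definition Ksat (S : finType) (F : interaction_family S) (k : nat) :
    {set {ffun 'I_k -> S}} :=
  [set s | F k s].

Definition loopblind (S : finType) (F : interaction_family S) : Prop :=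
  forall k : nat, (0 < k)%N -> forall A : {mset 'I_k},
    ~ constant_fun (Phi_mset F A) ->
    exists! A' : {set 'I_k},
      {subset A' <= A} /\
      forall s : {ffun 'I_k -> S}, Phi_mset F A s = Phi_set F A' s.

(* {dffun forall _ : 'I_k, S} is {ffun 'I_k -> S} with the library's direct
   product group structure. Every right coset of a subgroup is a left coset of a
   conjugate subgroup, so the side is immaterial. *)
Definition group_coset (S : finGroupType) (F : interaction_family S) : Prop :=
  forall k : nat,
    exists (H : {group {dffun forall _ : 'I_k, S}})
      (x : {dffun forall _ : 'I_k, S}),
      Ksat F k = (x *: H)%g.

Definition globally_satisfiable (S : finType) (F : interaction_family S) :
    Prop :=
  exists s : S, forall k : nat, F k [ffun=> s].

(* A partition T = I \sqcup D (blocks possibly empty) is given by D alone: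
   [inside D] is the index set D, and [outside D] is I = T \ D. *)
Definition inside (T : finType) (D : {set T}) : finType := {i : T | i \in D}.
Definition outside (T : finType) (D : {set T}) : finType :=
  {i : T | i \notin D}.

(* (s, t) with s placed on T \ D and t placed on D *)
Definition combine (S T : finType) (D : {set T})
    (s : {ffun outside D -> S}) (t : {ffun inside D -> S}) : {ffun T -> S} :=
  [ffun i => match boolP (i \in D) with
             | AltTrue h => t (exist _ i h)
             | AltFalse h => s (exist _ i h)
             end].

Definition dependency_map (S : finType) (F : interaction_family S) (k : nat)
    (D : {set 'I_k})
    (sigma : {ffun outside D -> S} -> {ffun inside D -> S}) : Prop :=
  Ksat F k = [set combine s (sigma s) | s : {ffun outside D -> S}].

Definition functionally_representable (S : finType)
    (F : interaction_family S) : Prop :=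
  forall k : nat, exists (D : {set 'I_k})
    (sigma : {ffun outside D -> S} -> {ffun inside D -> S}),
    dependency_map F sigma.

Section Extension.
Variables (S : finType) (k k' : nat) (lekk' : (k <= k')%N) (D : {set 'I_k}).

(* D regarded as a subset of [k'] *)
Definition widen_set : {set 'I_k'} := [set widen_ord lekk' i | i in D].

Lemma widen_outsideP (i : outside D) : widen_ord lekk' (val i) \notin widen_set.
Proof.
rewrite mem_imset; first exact: (valP i).
by move=> x y /(congr1 val) /= /val_inj.
Qed.

Definition widen_outside (i : outside D) : outside widen_set :=
  exist _ (widen_ord lekk' (val i)) (widen_outsideP i).

Lemma narrow_insideP (j : inside widen_set) :
  {i : inside D | widen_ord lekk' (val i) = val j}.
Proof.
apply: sig_eqW; have /imsetP[i iD ->] := valP j.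
by exists (exist _ i iD).
Qed.

Definition narrow_inside (j : inside widen_set) : inside D :=
  sval (narrow_insideP j).

Definition hat_sigma (sigma : {ffun outside D -> S} -> {ffun inside D -> S})
    (s : {ffun outside widen_set -> S}) : {ffun 'I_k' -> S} :=
  combine s
    [ffun j => sigma [ffun i => s (widen_outside i)] (narrow_inside j)].

End Extension.

Arguments hat_sigma {S k k'} lekk' {D} sigma s.

(* A' \subseteq [k'] \ D is a set of elements of the index type [k'] \ D. *)
Definition contraction_closed (S : finType) (F : interaction_family S) :
    Prop :=
  forall (k k' : nat) (lekk' : (k <= k')%N) (D : {set 'I_k})
    (sigma : {ffun outside D -> S} -> {ffun inside D -> S}),
    dependency_map F sigma ->
    forall A : {set 'I_k'},
      constant_fun (fun s => Phi_set F A (hat_sigma lekk' sigma s)) \/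
      exists! A' : {set outside (widen_set lekk' D)},
        forall s : {ffun outside (widen_set lekk' D) -> S},
          Phi_set F A (hat_sigma lekk' sigma s) = Phi_set F A' s.

(* A boolean model with state space S, variables V and interactions E. *)
Definition model (S V E : finType) : Type := E -> {ffun V -> S} -> bool.

Definition induced_model (S : finType) (G : hypergraph)
    (F : interaction_family S) : model S (vertex G) (hedge G) :=
  fun e => Phi_mset F (inc e).

Arguments induced_model {S} G F e _.

Definition nsat (S V E : finType) (M : model S V E) (A : {set E}) : nat :=
  #|[set s : {ffun V -> S} | [forall e in A, M e s]]|.

Definition model_rank (R : realType) (S V E : finType) (M : model S V E)
    (A : {set E}) : \bar R :=
  if (0 < nsat M A)%N then
    (#|V|%:R - ln (nsat M A)%:R / ln #|S|%:R)%:E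
  else +oo%E.

Record polymatroid (R : realType) (E : finType) := Polymatroid {
  prank :> {set E} -> R;
  prank_ge0 : forall A : {set E}, 0 <= prank A;
  prank0 : prank set0 = 0;
  prank_mono : forall A B : {set E}, A \subset B -> prank A <= prank B;
  prank_submod : forall A B : {set E},
    prank (A :|: B) + prank (A :&: B) <= prank A + prank B;
  prank_nat : forall A : {set E}, prank A \is a Num.nat
}.

(* Main.v *)
Require Import Defs.
From mathcomp Require Import all_boot all_order all_algebra all_fingroup.
From mathcomp Require Import finmap multiset.
From mathcomp Require Import reals constructive_ereal exp.
From mathcomp Require Import zify.

(** Write N(A) for the number of states satisfying every hyperedge of A, so that
    the rank of A is |V| minus the logarithm of N(A) to base q = |S|. The theorem
    amounts to three facts about N.

    N(A) is positive and N decreases as A grows. Positivity is global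
    satisfiability: the constant state s0 satisfies everything.

    N(A) N(B) <= N(A :|: B) N(A :&: B), which is submodularity of the rank. The
    solutions of one constraint form a coset, hence a set closed under
    a b^-1 c (a heap); so do the solutions of A, since such sets are stable under
    intersection. All these heaps contain the constant state s0, and translating
    s0 to the identity turns them into subgroups. For subgroups H, K of L the
    product formula |H| |K| = |HK| |H :&: K| and the inclusion of HK in L give the
    inequality ([heap_card_mul_le], [nsat_log_supermod]).

    N(A) is a power of q ([card_solutions]). This is Gaussian elimination. Pick a
    hyperedge e; functional representability makes some of its variables, D, a
    function of the others, so the states satisfying e are parametrized
    injectively by the states on V \ D. Contraction-closedness says that any other
    constraint, pulled back along this parametrization, is again a constraint
    on a subset of V \ D, or is constant. In the constant case it is constantly
    true because s0 satisfies everything, and then it is the constraint on the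
    empty set. Thus one hyperedge and the variables of D disappear together
    ([eliminate_hyperedge]); when no hyperedge is left, all states on the
    remaining variables are solutions. *)

Set Implicit Arguments.
Unset Strict Implicit.
Unset Printing Implicit Defensive.

Import Order.TTheory GRing.Theory Num.Theory.

Local Open Scope mset_scope.
Local Open Scope ring_scope.

(** * Constraints do not depend on the naming of variables *)

Section PhiSeq.
Variables (S : finType) (F : interaction_family S).

(** The arity in [Phi_seq] is the size of a sequence; allowing any provably equal
    arity here keeps casts out of the other proofs. *)
Lemma Phi_seq_tuple (I : finType) (n : nat) (t : n.-tuple I)
    (s : {ffun I -> S}) :
  Phi_seq F t s = F n [ffun i => s (tnth t i)].
Proof.
case: t => w /= sz_w; move: (sz_w); have /eqP-/esym eq_n := sz_w.
subst n => sz_w'; rewrite /Phi_seq.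
congr (F _ _); apply/ffunP=> i; rewrite !ffunE; congr (s _).
by have x0 := tnth (in_tuple w) i; rewrite !(tnth_nth x0).
Qed.

Lemma Phi_seq_map (I J : finType) (f : I -> J) (w : seq I)
    (s : {ffun J -> S}) :
  Phi_seq F (map f w) s = Phi_seq F w [ffun i => s (f i)].
Proof.
rewrite (Phi_seq_tuple (map_tuple f (in_tuple w))) /Phi_seq.
by congr (F _ _); apply/ffunP=> i; rewrite !ffunE tnth_map.
Qed.

Lemma perm_Phi_seq (I : finType) (w1 w2 : seq I) (s : {ffun I -> S}) :
  perm_eq w1 w2 -> Phi_seq F w1 s = Phi_seq F w2 s.
Proof.
move=> /(@tuple_permP _ _ _ (in_tuple w2))[p ->].
rewrite Phi_seq_tuple -[RHS](Phi_perm F p).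
by congr (F _ _); apply/ffunP=> i; rewrite !ffunE tnth_mktuple.
Qed.

Lemma Phi_set_preim (I J : finType) (f : I -> J) (A : {set J})
    (s : {ffun J -> S}) :
  bijective f -> Phi_set F A s = Phi_set F (f @^-1: A) [ffun i => s (f i)].
Proof.
move=> bij_f; rewrite /Phi_set -Phi_seq_map.
have inj_f := bij_inj bij_f; case: bij_f => g fK gK.
apply: perm_Phi_seq; apply: uniq_perm; rewrite ?enum_uniq //.
  by rewrite map_inj_uniq ?enum_uniq.
by move=> j; rewrite -(gK j) mem_map // !mem_enum inE gK.
Qed.

(** This is where looplessness enters: contraction-closedness speaks only of
    constraints on sets of variables. *)
Lemma Phi_mset_loopless (I : finType) (A : {mset I}) (s : {ffun I -> S}) :
  (forall i, (A i <= 1)%N) ->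
  Phi_mset F A s = Phi_set F [set i | i \in A] s.
Proof.
move=> A_le1; apply: perm_Phi_seq; apply: uniq_perm; rewrite ?enum_uniq //.
  apply: count_mem_uniq => i; rewrite count_mem_mset in_mset.
  by case: (A i) (A_le1 i) => [|[]].
by move=> i; rewrite mem_enum inE.
Qed.

End PhiSeq.

(** * Counting solutions by elimination *)

Section Elimination.
Variables (S : finType) (F : interaction_family S).

Lemma combine_outside (T : finType) (D : {set T}) (s : {ffun outside D -> S})
    (t : {ffun inside D -> S}) (i : T) (Di : i \notin D) :
  combine s t i = s (exist _ i Di).
Proof.
rewrite ffunE; destruct (boolP (i \in D)) as [Di'|Di'].
  by have := Di; rewrite Di'.
by congr (s _); apply: val_inj.
Qed.

Lemma combine_inside (T : finType) (D : {set T}) (s : {ffun outside D -> S})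
    (t : {ffun inside D -> S}) (i : T) (Di : i \in D) :
  combine s t i = t (exist _ i Di).
Proof.
rewrite ffunE; destruct (boolP (i \in D)) as [Di'|Di'].
  by congr (t _); apply: val_inj.
by have := Di'; rewrite Di.
Qed.

Section Hat.
Variables (k n : nat) (le_kn : (k <= n)%N) (D : {set 'I_k}).
Variable sigma : {ffun outside D -> S} -> {ffun inside D -> S}.

Lemma hat_sigma_outside (s : {ffun outside (widen_set le_kn D) -> S})
    (j : outside (widen_set le_kn D)) :
  hat_sigma le_kn sigma s (val j) = s j.
Proof. by case: j => j Dj; apply: combine_outside. Qed.

Lemma hat_sigma_inj : injective (hat_sigma le_kn sigma).
Proof.
move=> s1 s2 eq_hat; apply/ffunP=> j.
by rewrite -(hat_sigma_outside s1) eq_hat hat_sigma_outside.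
Qed.

Lemma hat_sigma_widen (s : {ffun outside (widen_set le_kn D) -> S}) :
  let s' := [ffun i => s (widen_outside le_kn i)] in
  [ffun i => hat_sigma le_kn sigma s (widen_ord le_kn i)] =
    combine s' (sigma s').
Proof.
move=> s'; apply/ffunP=> i; rewrite ffunE.
have [Di|nDi] := boolP (i \in D).
  have Dj : widen_ord le_kn i \in widen_set le_kn D by apply: imset_f.
  rewrite /hat_sigma (combine_inside _ _ Dj) (combine_inside _ _ Di) ffunE.
  congr (sigma _ _); apply: val_inj.
  rewrite /narrow_inside; case: narrow_insideP => i' /= eq_i.
  by apply: val_inj; have /= := congr1 val eq_i.
rewrite (combine_outside _ _ nDi) [RHS]ffunE.
have nDj : widen_ord le_kn i \notin widen_set le_kn D.
  exact: (widen_outsideP le_kn (exist _ i nDi)).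
rewrite /hat_sigma (combine_outside _ _ nDj).
by congr (s _); apply: val_inj.
Qed.

Lemma Phi_set_widen (t : {ffun 'I_n -> S}) :
  Phi_set F [set widen_ord le_kn i | i : 'I_k] t =
    F k [ffun i => t (widen_ord le_kn i)].
Proof.
transitivity (Phi_seq F (map (widen_ord le_kn) (ord_tuple k)) t).
  apply: perm_Phi_seq; apply: uniq_perm; rewrite ?enum_uniq //.
    by rewrite map_inj_uniq ?enum_uniq // => i j /(congr1 val) /= /val_inj.
  move=> j; rewrite mem_enum; apply/imsetP/mapP => [[i _ ->]|[i _ ->]];
    by exists i; rewrite // mem_enum.
rewrite Phi_seq_map Phi_seq_tuple; congr (F _ _).
by apply/ffunP=> i; rewrite !ffunE tnth_ord_tuple.
Qed.

(** [hat_sigma] parametrizes the solutions of the constraint on the first k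
    variables; with [hat_sigma_inj], bijectively. *)
Lemma codom_hat_sigma (t : {ffun 'I_n -> S}) :
  dependency_map F sigma ->
  Phi_set F [set widen_ord le_kn i | i : 'I_k] t =
    (t \in codom (hat_sigma le_kn sigma)).
Proof.
move=> KE; rewrite Phi_set_widen; apply/idP/codomP => [Ft | [s ->]]; last first.
  suff : [ffun i => hat_sigma le_kn sigma s (widen_ord le_kn i)] \in Ksat F k.
    by rewrite inE.
  by rewrite KE hat_sigma_widen; apply/imsetP; eexists.
have : [ffun i => t (widen_ord le_kn i)] \in Ksat F k by rewrite inE.
rewrite KE => /imsetP[s1 _ /ffunP tE].
(* The parameter of t can only be its restriction to the free variables. *)
exists [ffun j => t (val j)]; apply/ffunP=> j; rewrite /hat_sigma.
have [Dj|nDj] := boolP (j \in widen_set le_kn D); last first.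
  by rewrite (combine_outside _ _ nDj) ffunE.
rewrite (combine_inside _ _ Dj) ffunE.
have -> : [ffun i => [ffun j0 => t (val j0)] (widen_outside le_kn i)] = s1.
  apply/ffunP=> i; rewrite !ffunE; have := tE (val i); rewrite ffunE.
  by case: i => i nDi /= ->; apply: combine_outside.
rewrite /narrow_inside; case: narrow_insideP => -[i Di] /= <-.
by have := tE i; rewrite ffunE (combine_inside _ _ Di).
Qed.

End Hat.

Variable s0 : S.
Hypothesis Hsat : forall k : nat, F k [ffun=> s0].

Lemma Phi_seq_const (I : finType) (w : seq I) : Phi_seq F w [ffun=> s0].
Proof.
rewrite /Phi_seq; set s := finfun _; suff -> : s = [ffun=> s0] by [].
by apply/ffunP=> i; rewrite !ffunE.
Qed.

Lemma Phi_set0 (I : finType) (s : {ffun I -> S}) : Phi_set F set0 s.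
Proof.
rewrite /Phi_set enum_set0 (Phi_seq_tuple F [tuple]).
suff -> : [ffun i => s (tnth [tuple] i)] = [ffun=> s0] by apply: Hsat.
by apply/ffunP=> -[].
Qed.

Hypothesis Hcontr : contraction_closed F.

(** A constraint that becomes constant under [hat_sigma] is constantly true: the
    constant state s0 satisfies the eliminated constraint, so it lies in the
    image of [hat_sigma], and it satisfies every other constraint. Hence the
    first alternative of contraction-closedness is the second one with the
    empty set, whose constraint always holds. *)
Lemma contract_constraint (k n : nat) (le_kn : (k <= n)%N) (D : {set 'I_k})
    (sigma : {ffun outside D -> S} -> {ffun inside D -> S}) (A : {set 'I_n}) :
  dependency_map F sigma ->
  exists A' : {set outside (widen_set le_kn D)},
    forall s, Phi_set F A (hat_sigma le_kn sigma s) = Phi_set F A' s.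
Proof.
move=> Hsigma; have [[c cE]|[A' [A'E _]]] := Hcontr le_kn Hsigma A; last first.
  by exists A'.
exists set0 => s; rewrite Phi_set0 cE.
have /codomP[s1 s1E] :
    ([ffun=> s0] : {ffun 'I_n -> S}) \in codom (hat_sigma le_kn sigma).
  by rewrite -codom_hat_sigma //; apply: Phi_seq_const.
by rewrite -(cE s1) -s1E; apply: Phi_seq_const.
Qed.

Hypothesis Hfun : functionally_representable F.

Definition solutions (V : finType) (l : seq {set V}) : {set {ffun V -> S}} :=
  [set s | all (fun A => Phi_set F A s) l].

(** Contraction-closedness eliminates variables of an initial segment of 'I_n, so
    the vertices are numbered with those of e in front. *)
Lemma initial_numbering (V : finType) (e : {set V}) :
  exists2 f : 'I_#|V| -> V, bijective f
    & forall i, (f i \in e) = (i < #|e|)%N.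
Proof.
pose w := enum e ++ enum (~: e).
have sz_w : size w == #|V| by rewrite size_cat -!cardE cardsC.
pose t := Tuple sz_w.
have uniq_w : uniq w.
  rewrite cat_uniq !enum_uniq andbT /=; apply/hasPn=> v.
  by rewrite !mem_enum inE.
exists (tnth t) => [|i].
  apply: inj_card_bij; last by rewrite card_ord.
  move=> i j; rewrite (tnth_nth (tnth t i)) (tnth_nth (tnth t i) _ j) => /eqP.
  by rewrite nth_uniq ?(eqP sz_w) // => /eqP /val_inj.
rewrite (tnth_nth (tnth t i)) /= nth_cat -cardE; case: ltnP => [lt_i|le_i].
  by rewrite -mem_enum mem_nth // -cardE.
apply/negbTE; rewrite -in_setC -mem_enum mem_nth // -cardE.
by rewrite ltn_subLR // cardsC.
Qed.

(** The parametrization [h] of the solutions of e by the states on the free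
    variables is injective, and it carries the constraints of l back to
    constraints on the free variables, one for each. *)
Lemma eliminate_hyperedge (V : finType) (e : {set V}) (l : seq {set V}) :
  exists (W : finType) (l' : seq {set W}),
    size l' = size l /\ #|solutions (e :: l)| = #|solutions l'|.
Proof.
have [f bij_f fE] := initial_numbering e.
have le_kn : (#|e| <= #|V|)%N := max_card e.
have [D [sigma Hsigma]] := Hfun #|e|.
have e_init : f @^-1: e = [set widen_ord le_kn i | i : 'I_#|e|].
  apply/setP=> i; rewrite inE fE; apply/idP/imsetP => [lt_i|[j _ ->]] //=.
  by exists (Ordinal lt_i) => //; apply: val_inj.
have /fin_all_exists[c cE] :=
  fun A : {set V} => contract_constraint le_kn (f @^-1: A) Hsigma.
exists (outside (widen_set le_kn D)), (map c l).
split; first by rewrite size_map.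
have [g fK gK] := bij_f.
pose h (s : {ffun outside (widen_set le_kn D) -> S}) : {ffun V -> S} :=
  [ffun v => hat_sigma le_kn sigma s (g v)].
have hf s : [ffun i => h s (f i)] = hat_sigma le_kn sigma s.
  by apply/ffunP=> i; rewrite !ffunE fK.
have inj_h : injective h.
  move=> s1 s2 eq_h; apply: (@hat_sigma_inj _ _ le_kn _ sigma).
  by rewrite -!hf eq_h.
rewrite -(card_imset _ inj_h); apply: eq_card => t; rewrite !inE /=.
rewrite (Phi_set_preim F e t bij_f) e_init (codom_hat_sigma _ _ Hsigma).
have all_h s : all (fun A => Phi_set F A (h s)) l =
    all (fun A => Phi_set F A s) (map c l).
  rewrite all_map; apply: eq_all => A /=.
  by rewrite (Phi_set_preim F A _ bij_f) hf cE.
apply/andP/imsetP => [[/codomP[s tE] lt]|[s]]; last first.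
  rewrite inE -all_h => ls ->; split=> //.
  by rewrite hf codom_f.
exists s; last first.
  by apply/ffunP=> v; rewrite ffunE -tE ffunE gK.
rewrite inE -all_h (_ : h s = t) //.
by apply/ffunP=> v; rewrite ffunE -tE ffunE gK.
Qed.

Lemma card_solutions (V : finType) (l : seq {set V}) :
  exists m, #|solutions l| = (#|S| ^ m)%N.
Proof.
have [n] := ubnP (size l); elim: n => // n IHn in V l *.
case: l => [|e l] /=; first by exists #|V|; rewrite -card_ffun cardsT.
rewrite ltnS => lt_l; have [W [l' [sz_l' ->]]] := eliminate_hyperedge e l.
by apply: IHn; rewrite sz_l'.
Qed.

End Elimination.

(** * Cosets and intersections of solution sets *)

Section Heap.
Variable gT : finGroupType.
Local Open Scope group_scope.

(** The nonempty sets with this property are exactly the cosets of subgroups. As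
    a universally quantified closure condition it passes at once to intersections
    and to preimages under homomorphisms. *)
Definition heap_closed (K : {set gT}) : Prop :=
  forall a b c, a \in K -> b \in K -> c \in K -> a * b^-1 * c \in K.

Lemma heap_group_set (K : {set gT}) (c : gT) :
  heap_closed K -> c \in K -> group_set (c^-1 *: K).
Proof.
move=> K_heap Kc; apply/group_setP; split.
  by rewrite mem_lcoset invgK mulg1.
move=> x y; rewrite !mem_lcoset !invgK => Kx Ky.
by have := K_heap _ _ _ Kx Kc Ky; rewrite !mulgA mulgKV.
Qed.

(** After translating c to the identity, K, L and M are subgroups, and the product
    of the first two is contained in the third. *)
Lemma heap_card_mul_le (K L M : {set gT}) (c : gT) :
  heap_closed K -> heap_closed L -> heap_closed M -> c \in K :&: L ->
  K \subset M -> L \subset M -> (#|K| * #|L| <= #|K :&: L| * #|M|)%N.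
Proof.
move=> K_heap L_heap M_heap /setIP[Kc Lc] KM LM.
have Mc := subsetP KM _ Kc.
pose GK := Group (heap_group_set K_heap Kc).
pose GL := Group (heap_group_set L_heap Lc).
pose GM := Group (heap_group_set M_heap Mc).
have := mul_cardG GK GL; rewrite /= !card_lcoset => ->.
rewrite mulnC leq_mul //.
  rewrite (_ : _ :&: _ = c^-1 *: (K :&: L)) ?card_lcoset //.
  by apply/setP=> x; rewrite inE !mem_lcoset inE.
rewrite -(card_lcoset M c^-1); apply/subset_leq_card.
by apply: (@mul_subG _ GM); apply: mulgS.
Qed.

Lemma lcoset_heap (H : {group gT}) (x : gT) : heap_closed (x *: H).
Proof.
move=> _ _ _ /lcosetP[a Ha ->] /lcosetP[b Hb ->] /lcosetP[c Hc ->].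
by rewrite invMg !mulgA mulgKV mem_lcoset !mulgA mulVg mul1g !groupM ?groupV.
Qed.

End Heap.

Section Solutions.
Variables (S : finGroupType) (F : interaction_family S).
Hypothesis Hcoset : group_coset F.

(** The solution set is the preimage of [Ksat] under the homomorphism r that reads
    off the entries of a state along w. *)
Lemma Phi_seq_heap (I : finType) (w : seq I) :
  heap_closed ([set s | Phi_seq F w s] : {set {dffun forall _ : I, S}}).
Proof.
move=> a b c; rewrite !inE /Phi_seq.
have [H [x KE]] := Hcoset (size w); have := @lcoset_heap _ H x.
rewrite -KE.
pose r (s : {ffun I -> S}) : {dffun forall _ : 'I_(size w), S} :=
  [ffun i => s (tnth (in_tuple w) i)].
move=> /(_ (r a) (r b) (r c)); rewrite !inE => KabC Ka Kb Kc.
have -> : [ffun i => (a * b^-1 * c)%g (tnth (in_tuple w) i)] =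
  (r a * (r b)^-1 * r c)%g.
  by apply/ffunP=> i; rewrite !ffunE.
exact: KabC.
Qed.

End Solutions.

(** * The rank function *)

Lemma polymatroid_of_corank (R : realType) (E : finType) (n : nat)
    (c : {set E} -> nat) :
  c set0 = n ->
  (forall A B : {set E}, A \subset B -> (c B <= c A)%N) ->
  (forall A B : {set E}, (c A + c B <= c (A :|: B) + c (A :&: B))%N) ->
  exists P : polymatroid R E, forall A, P A = (n - c A)%:R.
Proof.
move=> c0 c_anti c_super.
have c_le A : (c A <= n)%N by rewrite -c0 c_anti ?sub0set.
pose r A : R := (n - c A)%:R.
have r0 : r set0 = 0 by rewrite /r c0 subnn.
have r_mono (A B : {set E}) : A \subset B -> r A <= r B.
  by move=> /c_anti le_BA; rewrite ler_nat leq_sub2l.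
have r_submod A B : r (A :|: B) + r (A :&: B) <= r A + r B.
  rewrite -!natrD ler_nat; have := c_super A B.
  (* The bounds ensure that none of the four subtractions truncates. *)
  have := c_le A; have := c_le B.
  have := c_le (A :|: B); have := c_le (A :&: B); lia.
have r_ge0 A : 0 <= r A by apply: ler0n.
have r_nat A : r A \is a Num.nat by apply: natr_nat.
by exists (Polymatroid r_ge0 r0 r_mono r_submod r_nat).
Qed.

Section InducedModel.
Variables (S : finGroupType) (F : interaction_family S) (G : hypergraph).
Hypothesis Hcoset : group_coset F.
Variable s0 : S.
Hypothesis Hsat : forall k : nat, F k [ffun=> s0].

Let sat (A : {set hedge G}) : {set {dffun forall _ : vertex G, S}} :=
  [set s | [forall e in A, induced_model G F e s]].

(** The solution sets of A and of B are heaps through s0 inside that of A :&: B,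
    and they meet in the solution set of A :|: B. *)
Lemma nsat_log_supermod (A B : {set hedge G}) :
  (nsat (induced_model G F) A * nsat (induced_model G F) B <=
     nsat (induced_model G F) (A :|: B) * nsat (induced_model G F) (A :&: B))%N.
Proof.
have heap_sat C : heap_closed (sat C).
  move=> a b c; rewrite !inE => /forall_inP aC /forall_inP bC /forall_inP cC.
  apply/forall_inP=> e Ce; have := @Phi_seq_heap _ _ Hcoset _ (inc e) a b c.
  by rewrite !inE; apply; [apply: aC | apply: bC | apply: cC].
have s0_sat C : ([ffun=> s0] : {dffun forall _ : vertex G, S}) \in sat C.
  by rewrite inE; apply/forall_inP=> e _; apply: Phi_seq_const.
have sat_anti (C C' : {set hedge G}) : C \subset C' -> sat C' \subset sat C.
  move=> sCC'; apply/subsetP=> s; rewrite !inE => /forall_inP sC'.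
  by apply/forall_inP=> e Ce; apply/sC'/(subsetP sCC').
have satU : sat (A :|: B) = sat A :&: sat B.
  apply/eqP; rewrite eqEsubset subsetI !sat_anti ?subsetUl ?subsetUr //=.
  apply/subsetP=> s; rewrite !inE => /andP[/forall_inP sA /forall_inP sB].
  by apply/forall_inP=> e; rewrite inE => /orP[/sA|/sB].
have := @heap_card_mul_le _ (sat A) (sat B) (sat (A :&: B)) [ffun=> s0].
rewrite -satU; apply=> //; apply: sat_anti; [exact: subsetIl | exact: subsetIr].
Qed.

Hypothesis Hfun : functionally_representable F.
Hypothesis Hcontr : contraction_closed F.
Hypothesis HG : loopless G.

Lemma nsat_pow (A : {set hedge G}) :
  exists m, nsat (induced_model G F) A = (#|S| ^ m)%N.
Proof.
have [m mE] := card_solutions Hsat Hcontr Hfun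
  [seq [set v | v \in inc e] | e <- enum A].
exists m; rewrite -mE; apply: eq_card => s; rewrite !inE all_map.
apply/forall_inP/allP => sA e; first rewrite mem_enum /= => Ae.
  by rewrite -Phi_mset_loopless; [apply: sA | apply: HG].
move=> Ae; have /= := sA e; rewrite mem_enum -Phi_mset_loopless; last exact: HG.
exact.
Qed.

(** The rounding in [trunc_log] is harmless: [nsat_corank] shows that the logarithm
    is exact. Working with natural numbers makes integrality of the rank
    immediate. *)
Definition corank (A : {set hedge G}) : nat :=
  trunc_log #|S| (nsat (induced_model G F) A).

Lemma nsat_corank A : nsat (induced_model G F) A = (#|S| ^ corank A)%N.
Proof.
by have [m mE] := nsat_pow A; rewrite /corank mE trunc_expnK ?card_state_gt1.
Qed.

Lemma corank_anti (A B : {set hedge G}) :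
  A \subset B -> (corank B <= corank A)%N.
Proof.
move=> sAB; apply: leq_trunc_log; apply/subset_leq_card/subsetP=> s.
rewrite !inE => /forall_inP sB; apply/forall_inP=> e Ae.
exact/sB/(subsetP sAB).
Qed.

Lemma corank0 : corank set0 = #|vertex G|.
Proof.
apply/eqP; rewrite -(eqn_exp2l _ _ (card_state_gt1 F)) -nsat_corank.
rewrite -card_ffun -cardsT; apply/eqP/eq_card=> s; rewrite !inE.
by apply/forall_inP=> e; rewrite inE.
Qed.

Lemma corank_supermod (A B : {set hedge G}) :
  (corank A + corank B <= corank (A :|: B) + corank (A :&: B))%N.
Proof.
rewrite -(leq_exp2l _ _ (card_state_gt1 F)) !expnD -!nsat_corank.
exact: nsat_log_supermod.
Qed.

Lemma model_rank_corank (R : realType) (A : {set hedge G}) :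
  model_rank R (induced_model G F) A = (#|vertex G| - corank A)%:R%:E.
Proof.
have S_gt1 := card_state_gt1 F; have S_gt0 : (0 < #|S|)%N by apply: ltnW.
rewrite /model_rank nsat_corank expn_gt0 S_gt0 /=; congr (_%:E).
rewrite natrB; last by rewrite -corank0 corank_anti ?sub0set.
rewrite natrX lnXn ?ltr0n // -[ln _ *+ _]mulr_natl mulfK //.
by rewrite gt_eqF // ln_gt0 ?ltr1n.
Qed.

End InducedModel.

Theorem corollary4p10 (R : realType) (S : finGroupType)
    (F : interaction_family S)
    (Hloopblind : loopblind F)
    (Hcoset : group_coset F)
    (Hsat : globally_satisfiable F)
    (Hfun : functionally_representable F)
    (Hcontr : contraction_closed F)
    (G : hypergraph) (HG : loopless G) :
  exists P : polymatroid R (hedge G),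
    forall A : {set hedge G}, model_rank R (induced_model G F) A = (P A)%:E.
Proof.
have [s0 Hs0] := Hsat.
have [P PE] := polymatroid_of_corank R (corank0 Hs0 Hfun Hcontr HG)
  (@corank_anti _ F G) (corank_supermod Hcoset Hs0 Hfun Hcontr HG).
by exists P => A; rewrite PE (model_rank_corank Hs0 Hfun Hcontr HG).
Qed.
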